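(* For any positive integers $s\geq 2$ and $k$, there is a positive constant $c=c(k,s)$ such that for every integer $t>(s-1)!$, if $n$ is sufficiently large (in terms of $k,s,t$), then $$\mathrm{ex}(n,K_{s,t}^{(2k)})\geq c\,t^{\frac{1}{s-1}}n^{2k-\frac{1}{s-1}}.$$
   Context: For an $r$-uniform hypergraph $H$, $\mathrm{ex}(n,H)$ denotes the largest number of edges in an $r$-uniform hypergraph on $n$ vertices containing no copy of $H$ (as a not necessarily induced subhypergraph). For positive integers $r,s,t$, $K_{s,t}^{(r)}$ denotes the $r$-uniform hypergraph whose vertex set is the union of pairwise disjoint sets $X,Y_1,\dots,Y_t$ with $|X|=s$ and $|Y_1|=\dots=|Y_t|=r-1$, and whose edge set is $\{\{x\}\cup Y_i : x\in X,\ 1\leq i\leq t\}$. Here $r=2k$. *)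

(* Defs.v *)
From mathcomp Require Import all_boot all_order all_algebra.
From mathcomp Require Import reals exp.

Set Implicit Arguments.
Unset Strict Implicit.
Unset Printing Implicit Defensive.

(* A hypergraph with vertex set V is represented by its edge set. *)
Notation hypergraph V := {set {set V}}.

Definition uniform (r : nat) (V : finType) (G : hypergraph V) : bool :=
  [forall e in G, #|e| == r].

(* Copies are not required to be induced. *)
Definition has_copy (U V : finType) (H : hypergraph U) (G : hypergraph V) :
  bool :=
  [exists f : {ffun U -> V}, injectiveb f && [forall e in H, f @: e \in G]].

Definition ex (r n : nat) (U : finType) (H : hypergraph U) : nat :=
  \max_(G : hypergraph 'I_n | uniform r G && ~~ has_copy H G) #|G|.

(* inl x is a vertex x of X, and inr (i, j) is the j-th vertex of Y_i. *)
Definition Kvertex (r s t : nat) : finType := ('I_s + 'I_t * 'I_r.-1)%type.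

Definition Yset (r s t : nat) (i : 'I_t) : {set Kvertex r s t} :=
  [set inr (i, j) | j : 'I_r.-1].

Definition K (r s t : nat) : hypergraph (Kvertex r s t) :=
  [set inl x |: Yset r s i | x : 'I_s, i : 'I_t].

Lemma K_uniform (r s t : nat) : 0 < r -> uniform r (K r s t).
Proof.
move=> r_gt0; apply/forall_inP => e /imset2P[x i _ _ ->].
rewrite cardsU1 card_imset; last by move=> j j' [].
rewrite card_ord; case: imsetP => [[j _ //]|_].
by rewrite add1n prednK.
Qed.

(* Main.v *)
(* Let d = s - 1, let q be a power of 2, let L be the field with q^d elements
   and N x = x^(1 + q + ... + q^(d-1)) its norm to the field with q elements.
   The vertices form 2k copies of L grouped into k pairs; the edges are the
   transversals (a_1, b_1, ..., a_k, b_k) such that prod_i N(a_i + b_i) lies in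
   a geometric progression {g^c, ..., g^(c+h)}, where g generates the nonzero
   elements of the small field. By averaging, some c gives about (h/q) |L|^(2k)
   edges. In a copy of K_{s,t} the set X lies in a single part; the elements b
   that the Y_i contribute to the part paired with it are distinct, and the
   values N(x + b), x in X, are proportional to powers of g with exponents at
   most h. There are (2h+1)^d patterns of exponent differences, and each is
   realised by at most d! elements b, so it suffices that (2h+1)^d d! < t.

   The bound d! is a variant of the Kollar-Ronyai-Szabo lemma: if the a_ij
   (0 <= i <= d, 0 <= j < d) are distinct in i for each j, then the points z for
   which (prod_j (z_j - a_ij))_i is proportional to a given vector number at most
   d!. Put f_i = prod_j (z_j - a_ij), and let W_c be the space of functions on
   these points spanned by the monomials of degree < j + c in each z_j. Lagrange
   interpolation in one variable at a time gives W_2 = sum_i f_i W_1. The f_i are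
   proportional to one function y, so W_2 is contained in y W_1; comparing
   dimensions, W_1 = W_2. Hence W_1 is stable under multiplication by every z_j,
   so it contains all functions, while it is spanned by d! monomials. *)
From HB Require Import structures.
Require Import Defs.
From mathcomp Require Import all_boot all_order all_algebra.
From mathcomp Require Import all_solvable all_field.
From mathcomp Require Import zify reals exp.
Import Order.TTheory GRing.Theory Num.Theory.
Local Open Scope ring_scope.

Set Implicit Arguments.
Unset Strict Implicit.
Unset Printing Implicit Defensive.

(** * Staircase spaces of monomials and product systems *)

Definition fmul (F : fieldType) (T : finType) (f : T -> F)
  (v : {ffun T -> F^o}) : {ffun T -> F^o} := [ffun t => f t * v t].

Fact fmul_is_linear (F : fieldType) (T : finType) (f : T -> F) :
  linear (fmul f).
Proof.
by move=> a u v; apply/ffunP=> t; rewrite !ffunE mulrDr /GRing.scale /= mulrCA.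
Qed.

HB.instance Definition _ (F : fieldType) (T : finType) (f : T -> F) :=
  GRing.isLinear.Build F {ffun T -> F^o} {ffun T -> F^o} *:%R (fmul f)
    (fmul_is_linear f).

(** The difference of the two sides is a polynomial in [y] of degree less than [#|A|] that vanishes
    at the [#|A|] points [b i]. The coefficients [c] do not depend on [y], so a function can later
    take its place. *)
Lemma exprn_lagrange (F : fieldType) (I : finType) (A : {set I}) (b : I -> F)
    (e : nat) :
  {in A &, injective b} -> (e < #|A|)%N ->
  exists c : I -> F, forall y : F,
    y ^+ e = \sum_(i in A) c i * \prod_(j in A :\ i) (y - b j).
Proof.
move=> b_inj e_lt.
pose L i : {poly F} := \prod_(j in A :\ i) ('X - (b j)%:P).
have LE i y : (L i).[y] = \prod_(j in A :\ i) (y - b j).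
  by rewrite horner_prod; apply: eq_bigr => j _; rewrite hornerXsubC.
pose c i := b i ^+ e / (L i).[b i].
pose p : {poly F} := 'X^e - \sum_(i in A) c i *: L i.
exists c => y.
suff /eqP p0 : p == 0.
  have := congr1 (horner^~ y) p0; rewrite hornerD hornerN hornerXn horner0.
  move/eqP; rewrite subr_eq0 horner_sum => /eqP ->.
  by apply: eq_bigr => i _; rewrite hornerZ LE.
have size_p : (size p <= #|A|)%N.
  rewrite (leq_trans (size_polyD _ _)) // geq_max size_polyXn e_lt size_polyN.
  apply: (leq_trans (size_sum _ _ _)); apply/bigmax_leqP => i iA.
  rewrite (leq_trans (size_scale_leq _ _)) // /L.
  rewrite -big_enum (size_prod_XsubC _ b) -cardE.
  by rewrite (cardsD1 i A) iA add1n.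
apply: contraLR size_p => p_neq0; rewrite -ltnNge.
have := @max_poly_roots F p [seq b i | i <- enum A] p_neq0.
rewrite size_map -cardE; apply.
  apply/allP => _ /mapP[i + ->]; rewrite mem_enum => iA.
  rewrite /root hornerD hornerN hornerXn horner_sum (bigD1 i) //=.
  rewrite big1 ?addr0 => [|j /andP[jA ji]]; last first.
    rewrite hornerZ LE (bigD1 i) /= ?subrr ?mul0r ?mulr0 //.
    by rewrite !inE eq_sym ji.
  rewrite hornerZ /c divfK ?subrr // LE; apply/prodf_neq0 => j.
  rewrite !inE => /andP[ji jA]; rewrite subr_eq0.
  by apply: contraNneq ji => /b_inj->.
rewrite map_inj_in_uniq ?enum_uniq // => i j; rewrite !mem_enum.
exact: b_inj.
Qed.

(* The degree in x_j is less than j + c. *)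
Fixpoint stair (F : fieldType) (T : finType) (x : nat -> T -> F) (c d : nat) :
    seq {ffun T -> F^o} :=
  if d is d'.+1 then
    [seq fmul (fun t => x d' t ^+ e) g |
       e <- iota 0 (d' + c), g <- stair x c d']
  else [:: [ffun => 1]].

Definition stairs (F : fieldType) (T : finType) (x : nat -> T -> F)
  (c d : nat) : {vspace {ffun T -> F^o}} := <<stair x c d>>%VS.

Lemma size_stair (F : fieldType) (T : finType) (x : nat -> T -> F) d :
  size (stair x 1 d) = d`!.
Proof.
by elim: d => //= d IHd; rewrite size_allpairs size_iota IHd addn1 factS.
Qed.

Lemma stairsX (F : fieldType) (T : finType) (x : nat -> T -> F) c d e g :
  (e < d + c)%N -> g \in stairs x c d ->
  fmul (fun t => x d t ^+ e) g \in stairs x c d.+1.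
Proof.
move=> e_lt gW; rewrite -(lfunE (fmul (fun t => x d t ^+ e))).
rewrite (memv_preim (linfun (fmul (fun t => x d t ^+ e)))).
move: g gW; apply/subvP/span_subvP => g gS; rewrite -memv_preim lfunE.
by apply: memv_span; apply: allpairs_f; rewrite ?mem_iota.
Qed.

Lemma stairsS_ind (F : fieldType) (T : finType) (x : nat -> T -> F) c d
    (U : {vspace {ffun T -> F^o}}) :
  (forall e g, (e < d + c)%N -> g \in stairs x c d ->
     fmul (fun t => x d t ^+ e) g \in U) ->
  (stairs x c d.+1 <= U)%VS.
Proof.
move=> HU; apply/span_subvP => _ /allpairsP[[e g] /= [+ gS ->]].
by rewrite mem_iota => /= e_lt; apply: HU => //; apply: memv_span.
Qed.

Lemma stairs_horner (F : fieldType) (T : finType) (x : nat -> T -> F) c d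
    (p : {poly F}) g :
  (size p <= d + c)%N -> g \in stairs x c d ->
  fmul (fun t => p.[x d t]) g \in stairs x c d.+1.
Proof.
move=> p_le gW.
have -> : fmul (fun t => p.[x d t]) g =
    \sum_(e < size p) p`_e *: fmul (fun t => x d t ^+ e) g.
  apply/ffunP => t; rewrite sum_ffunE ffunE horner_coef mulr_suml.
  by apply: eq_bigr => e _; rewrite !ffunE /GRing.scale /= mulrA.
apply: memv_suml => e _; apply: memvZ; apply: stairsX => //.
exact: leq_trans p_le.
Qed.

Lemma sub_stairs (F : fieldType) (T : finType) (x : nat -> T -> F) d :
  (stairs x 1 d <= stairs x 2 d)%VS.
Proof.
elim: d => [|d IHd]; first exact: subvv.
apply: stairsS_ind => e g e_lt gW; apply: stairsX; last exact: (subvP IHd).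
by rewrite addnS ltnW.
Qed.

Lemma stairsM (F : fieldType) (T : finType) (x : nat -> T -> F) d j g :
  (j < d)%N -> g \in stairs x 1 d -> fmul (x j) g \in stairs x 2 d.
Proof.
move=> + gW; rewrite -(lfunE (fmul (x j))) memv_preim => jd.
move: g gW; apply/subvP.
elim: d jd => // d IHd; rewrite ltnS leq_eqVlt => jd.
apply: stairsS_ind => e g e_lt gW; rewrite -memv_preim lfunE /=.
case: eqVneq jd => [->|_] /= jd.
  have -> : fmul (x d) (fmul (fun t => x d t ^+ e) g) =
      fmul (fun t => x d t ^+ e.+1) g.
    by apply/ffunP => t; rewrite !ffunE exprS mulrA.
  apply: stairsX; first by rewrite addnS ltnS.
  exact: (subvP (sub_stairs x d)).
have -> : fmul (x j) (fmul (fun t => x d t ^+ e) g) =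
    fmul (fun t => x d t ^+ e) (fmul (x j) g).
  by apply/ffunP => t; rewrite !ffunE mulrCA.
apply: stairsX; first by rewrite addnS ltnW.
by have /subvP/(_ g gW) := IHd jd; rewrite -memv_preim lfunE.
Qed.

Lemma mem1_stairs (F : fieldType) (T : finType) (x : nat -> T -> F) d :
  [ffun => 1] \in stairs x 1 d.
Proof.
elim: d => [|d IHd]; first by rewrite memv_span ?mem_head.
have -> : [ffun => 1] = fmul (fun t => x d t ^+ 0) [ffun => 1].
  by apply/ffunP => t; rewrite !ffunE mulr1.
by apply: stairsX; rewrite ?addn1.
Qed.

(** Induction on [d]: powers of the last coordinate are interpolated at the nodes [a i d], and the
    term omitting [i] is handled by the induction hypothesis for [A :\ i]. *)
Lemma stairs2_sub (F : fieldType) (T I : finType) (x : nat -> T -> F)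
    (a : I -> nat -> F) (d : nat) (A : {set I}) :
  #|A| = d.+1 ->
  (forall j, (j < d)%N -> {in A &, injective (a^~ j)}) ->
  (stairs x 2 d <= \sum_(i in A)
     linfun (fmul (fun t => \prod_(j < d) (x j t - a i j)))
       @: stairs x 1 d)%VS.
Proof.
elim: d A => [|d IHd] A cardA a_inj.
  have [i iA] : exists i, i \in A by apply/card_gt0P; rewrite cardA.
  apply: (subv_trans _ (sumv_sup i iA (subvv _))).
  apply/subvP => g gW; apply/memv_imgP; exists g => //.
  by apply/ffunP => t; rewrite lfunE ffunE big_ord0 mul1r.
apply: stairsS_ind => e g; rewrite addn2 -cardA => e_lt gW.
have [c cE] := exprn_lagrange (a_inj d (ltnSn d)) e_lt.
have -> : fmul (fun t => x d t ^+ e) g = \sum_(i in A) c i *: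
    fmul (fun t => \prod_(j in A :\ i) (x d t - a j d)) g.
  apply/ffunP => t; rewrite sum_ffunE ffunE cE mulr_suml.
  by apply: eq_bigr => i _; rewrite !ffunE /GRing.scale /= mulrA.
apply: memv_suml => i iA; apply: memvZ.
have cardAi : #|A :\ i| = d.+1.
  by apply/eqP; rewrite -eqSS -cardA (cardsD1 i A) iA.
have a_injAi j : (j < d)%N -> {in A :\ i &, injective (a^~ j)}.
  by move=> jd u v /setD1P[_ uA] /setD1P[_ vA]; exact: (a_inj j (ltnW jd)).
have := subvP (IHd _ cardAi a_injAi) g gW.
move=> /memv_sumP[G GW ->]; rewrite linear_sum.
apply: memv_suml => l lAi; have /memv_imgP[v vW ->] := GW l lAi.
rewrite lfunE /=; have /setD1P[li lA] := lAi.
(* The factor for [l] completes the product with index [l]; the other [d] factors form [p], whose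
   degree is still allowed in [stairs x 1 d.+1]. *)
pose p : {poly F} := \prod_(j in A :\ i :\ l) ('X - (a j d)%:P).
suff -> : fmul (fun t => \prod_(j in A :\ i) (x d t - a j d))
    (fmul (fun t => \prod_(j < d) (x j t - a l j)) v) =
  linfun (fmul (fun t => \prod_(j < d.+1) (x j t - a l j)))
    (fmul (fun t => p.[x d t]) v).
  apply: (subvP (sumv_sup l lA (subvv _))); apply: memv_img.
  apply: stairs_horner => //; rewrite addn1 /p -big_enum.
  rewrite (size_prod_XsubC _ (a^~ d)) -cardE ltnS -ltnS -cardAi.
  by rewrite (cardsD1 l (A :\ i)) lAi.
apply/ffunP => t; rewrite !lfunE !ffunE /= big_ord_recr /= (big_setD1 l) //=.
have -> : p.[x d t] = \prod_(j in A :\ i :\ l) (x d t - a j d).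
  by rewrite /p horner_prod; apply: eq_bigr => j _; rewrite hornerXsubC.
rewrite !mulrA; congr (_ * _).
by rewrite mulrC mulrA.
Qed.

Lemma card_product_system (F : fieldType) (T : finType) (d : nat)
    (x : nat -> T -> F) (a : 'I_d.+1 -> nat -> F) (h : 'I_d.+1 -> F)
    (y : T -> F) :
  (forall t u, (forall j, (j < d)%N -> x j t = x j u) -> t = u) ->
  (forall j, (j < d)%N -> injective (a^~ j)) ->
  (forall i t, \prod_(j < d) (x j t - a i j) = h i * y t) ->
  (#|T| <= d`!)%N.
Proof.
move=> x_sep a_inj sys.
have W2_sub : (stairs x 2 d <= linfun (fmul y) @: stairs x 1 d)%VS.
  apply: subv_trans (stairs2_sub (a := a) (A := setT) x _ _) _.
  - by rewrite cardsT card_ord.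
  - by move=> j jd i i' _ _; apply: a_inj.
  apply/subv_sumP => i _; apply/subvP => _ /memv_imgP[g gW ->].
  have -> : linfun (fmul (fun t => \prod_(j < d) (x j t - a i j))) g =
      h i *: linfun (fmul y) g.
    by apply/ffunP => t; rewrite !lfunE !ffunE sys /GRing.scale /= mulrA.
  by rewrite memvZ // memv_img.
have W12 : stairs x 1 d = stairs x 2 d.
  apply/eqP; rewrite eqEdim sub_stairs /=; apply: leq_trans (dimvS W2_sub) _.
  rewrite -(limg_ker_dim (linfun (fmul y)) (stairs x 1 d)).
  exact: leq_addl.
have WM j g : (j < d)%N -> g \in stairs x 1 d -> fmul (x j) g \in stairs x 1 d.
  by move=> jd gW; rewrite W12 stairsM.
(* Multiplying by [x j - x j u], for a coordinate [j] that separates [t] from [u], kills the value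
   at [u] and keeps the one at [t] nonzero. *)
have sep (t : T) (s : seq T) : t \notin s ->
    exists2 v, v \in stairs x 1 d & v t != 0 /\ {in s, forall u, v u = 0}.
  elim: s => [_|u s IHs].
    by exists [ffun=> 1]; rewrite ?mem1_stairs // ffunE oner_neq0.
  rewrite inE negb_or => /andP[tu /IHs[v vW [vt vs]]].
  have [j] : exists j : 'I_d, x j t != x j u.
    apply/existsP; apply: contraNT tu; rewrite negb_exists => /forallP xE.
    by apply/eqP/x_sep => j jd; apply/eqP/negPn/(xE (Ordinal jd)).
  move=> xtu; exists (fmul (x j) v - x j u *: v).
    by rewrite memvB ?WM ?memvZ.
  rewrite !ffunE /GRing.scale /= -mulrBl mulf_eq0 subr_eq0 negb_or xtu vt.
  split=> // w; rewrite inE !ffunE /GRing.scale /= -mulrBl.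
  by case/predU1P=> [->|/vs->]; rewrite ?subrr ?mul0r ?mulr0.
have full : (fullv <= stairs x 1 d)%VS.
  apply/subvP => g _.
  have delta t : [ffun u => (u == t)%:R] \in stairs x 1 d.
    have [|v vW [vt v0]] := sep t (enum (predC1 t)).
      by rewrite mem_enum !inE eqxx.
    have -> : [ffun u => (u == t)%:R] = (v t)^-1 *: v.
      apply/ffunP => u; rewrite !ffunE /GRing.scale /=.
      have [->|ut] := eqVneq u t; first by rewrite mulVf.
      by have /v0-> : u \in enum (predC1 t); rewrite ?mem_enum ?mulr0.
    exact: memvZ.
  have -> : g = \sum_t g t *: [ffun u => (u == t)%:R].
    apply/ffunP => u; rewrite sum_ffunE (bigD1 u) //= big1 => [|t tu].
      by rewrite !ffunE eqxx /GRing.scale /= mulr1 addr0.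
    by rewrite !ffunE eq_sym (negPf tu) scaler0.
  by apply: memv_suml => t _; apply/memvZ/delta.
(* The dimension unfolds to [#|T|] times the dimension 1 of [F^o]. *)
have dimV : dim {ffun T -> F^o} = #|T| by rewrite [LHS]muln1.
rewrite -dimV -dimvf -(size_stair x d).
exact: leq_trans (dimvS full) (dim_span _).
Qed.

(** * Norms over finite fields *)

Lemma expf_pchar_inj (F : fieldType) n :
  [pchar F].-nat n -> injective (fun x : F => x ^+ n).
Proof.
move=> n_char x y /= xy; apply/eqP; rewrite -subr_eq0.
have n_gt0 : (0 < n)%N by case/andP: n_char.
have : (x - y) ^+ n == 0.
  by rewrite -(inj_eq (addIr (y ^+ n))) add0r -exprDn_pchar // subrK xy.
by rewrite expf_eq0 n_gt0.
Qed.

Definition qnorm (F : fieldType) (q d : nat) (x : F) : F :=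
  \prod_(j < d) x ^+ (q ^ j).

(** The total exponent of [x] is (q - 1)(1 + q + ... + q^(d-1)) = [#|F|] - 1. Treating nonzero norms
    as roots of unity avoids building the subfield. *)
Lemma qnorm_expn (F : finFieldType) (q d : nat) (x : F) :
  (0 < q)%N -> #|F| = (q ^ d)%N -> x != 0 -> qnorm q d x ^+ q.-1 = 1.
Proof.
move=> q_gt0 cardF x_neq0.
rewrite /qnorm prodrXr -exprM mulnC -predn_exp -cardF.
apply: (mulIf x_neq0); rewrite mul1r -exprSr prednK ?expf_card //.
by rewrite cardF expn_gt0 q_gt0.
Qed.

Lemma finField_prim_root (F : finFieldType) (m : nat) :
  (m %| #|F|.-1)%N -> exists g : F, m.-primitive_root g.
Proof.
move=> m_dvd; have F_gt1 := finNzRing_gt1 F.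
have /hasP[z _ z_prim] : has #|F|.-1.-primitive_root (enum (predC1 (0 : F))).
  apply: has_prim_root.
  - by rewrite -ltnS prednK // ltnW.
  - apply/allP => x; rewrite mem_enum !inE => x_neq0; apply/unity_rootP.
    apply: (mulIf x_neq0); rewrite mul1r -exprSr prednK ?expf_card //.
    exact: ltnW.
  - exact: enum_uniq.
  - by rewrite -cardE cardC1.
by exists (z ^+ (#|F|.-1 %/ m)); apply: dvdn_prim_root.
Qed.

(** Raising to the power [q ^ j] is additive, so the norms of [a i + b t] form a product system in
    the coordinates [b t ^+ (q ^ j)]. The coordinate [j = 0] alone separates the points. *)
Lemma card_qnorm_system (F : finFieldType) (q d : nat) (T : finType)
    (a : 'I_d.+1 -> F) (b : T -> F) (h : 'I_d.+1 -> F) (y : T -> F) :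
  [pchar F].-nat q -> (0 < d)%N -> injective a -> injective b ->
  (forall i t, qnorm q d (a i + b t) = h i * y t) ->
  (#|T| <= d`!)%N.
Proof.
move=> q_char d_gt0 a_inj b_inj sys.
have qj_char j : [pchar F].-nat (q ^ j)%N by rewrite pnatX q_char.
apply: (@card_product_system F T d (fun j t => b t ^+ (q ^ j))
  (fun i j => - (a i ^+ (q ^ j))) h y).
- by move=> t u /(_ 0%N d_gt0); rewrite !expr1 => /b_inj.
- by move=> j _ i i' /oppr_inj/(expf_pchar_inj (qj_char j))/a_inj.
move=> i t; rewrite -sys; apply: eq_bigr => j _.
by rewrite opprK exprDn_pchar // addrC.
Qed.

Lemma card_le_fibers (T P : finType) (f : T -> P) (m : nat) :
  (forall p, #|[set t | f t == p]| <= m)%N -> (#|T| <= #|P| * m)%N.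
Proof.
move=> fib; rewrite -sum1_card (partition_big f xpredT) //= -sum_nat_const.
by apply: leq_sum => p _; rewrite sum1dep_card.
Qed.

Lemma card_qnorm_progression (F : finFieldType) (q d h : nat) (T : finType)
    (a : 'I_d.+1 -> F) (b : T -> F) (g : F) (y : T -> F)
    (e : 'I_d.+1 -> T -> nat) :
  [pchar F].-nat q -> (0 < d)%N -> injective a -> injective b -> g != 0 ->
  (forall i t, e i t <= h)%N ->
  (forall i t, qnorm q d (a i + b t) = y t * g ^+ e i t) ->
  (#|T| <= h.*2.+1 ^ d * d`!)%N.
Proof.
move=> q_char d_gt0 a_inj b_inj g_neq0 e_le sys.
(* A pattern records the numbers e_i - e_0 + h, which lie in [0, 2h]. *)
pose pat t : {ffun 'I_d -> 'I_h.*2.+1} :=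
  [ffun i => inord (h + e (lift ord0 i) t - e ord0 t)].
have -> : (h.*2.+1 ^ d)%N = #|{ffun 'I_d -> 'I_h.*2.+1}|.
  by rewrite card_ffun !card_ord.
apply: (@card_le_fibers _ _ pat) => p; rewrite -card_sig.
(* Within a fibre the norms are proportional to these powers: index 0 has difference 0, recorded as
   [h], and [yy] absorbs the shift by e_0 - h. *)
pose hh (i : 'I_d.+1) :=
  g ^+ (if unlift ord0 i is Some j then p j : nat else h).
pose T' := {t | t \in [set t | pat t == p]}.
pose yy (t : T') := y (val t) * g ^+ e ord0 (val t) / g ^+ h.
apply: (@card_qnorm_system F q d _ a (fun t : T' => b (val t)) hh yy) => //.
  by move=> t u /b_inj/val_inj.
move=> i t; rewrite sys /yy.
have gh : g ^+ h != 0 by rewrite expf_neq0.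
apply: (mulIf gh); rewrite -[RHS]mulrA divfK // mulrCA -mulrA; congr (_ * _).
rewrite /hh -!exprD; congr (_ ^+ _).
case: unliftP => [j ->|->]; last by rewrite addnC.
case: t => t /=; rewrite inE => /eqP <-; rewrite !ffunE inordK; last first.
  by rewrite ltnS (leq_trans (leq_subr _ _)) // -addnn leq_add2l.
rewrite subnK 1?addnC // addnC.
exact: leq_trans (e_le _ _) (leq_addr _ _).
Qed.

(** * Transversal edges and copies of [K] *)

Definition transversal (J L U : finType) (iota : J * L -> U)
  (w : {ffun J -> L}) : {set U} := [set iota (j, w j) | j : J].

Lemma transversal_inj (J L U : finType) (iota : J * L -> U) :
  injective iota -> injective (transversal iota).
Proof.
move=> iota_inj w w' /setP ww'; apply/ffunP => j.
have : iota (j, w j) \in transversal iota w' by rewrite -ww' imset_f.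
by case/imsetP => j' _ /iota_inj[-> ->].
Qed.

Lemma card_transversal (J L U : finType) (iota : J * L -> U) w :
  injective iota -> #|transversal iota w| = #|J|.
Proof. by move=> iota_inj; rewrite card_imset // => j j' /iota_inj[]. Qed.

(* Y_i meets exactly the parts avoided by any given vertex of X, so all of X
   lies in one part j0. *)
Lemma K_copy_transversal (J L U : finType) (iota : J * L -> U) (r s t : nat)
    (phi : Kvertex r s t -> U) (w : 'I_s -> 'I_t -> {ffun J -> L}) :
  injective iota -> injective phi -> (0 < s)%N -> (0 < t)%N ->
  (forall x i, phi @: (inl x |: Yset r s i) = transversal iota (w x i)) ->
  exists (j0 : J) (a : 'I_s -> L),
    [/\ injective a, forall x i, w x i j0 = a x,
        forall x x' i j, j != j0 -> w x i j = w x' i j &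
        forall x j, j != j0 -> injective (fun i => w x i j)].
Proof.
move=> iota_inj phi_inj s_gt0 t_gt0 copyE.
pose i0 := Ordinal t_gt0; pose x0 := Ordinal s_gt0.
have /fin_all_exists[p pE] x : exists p : J * L, phi (inl x) = iota p.
  have : phi (inl x) \in transversal iota (w x i0).
    by rewrite -copyE imset_f ?setU11.
  by case/imsetP => j _ ->; exists (j, w x i0 j).
have wp x i : w x i (p x).1 = (p x).2.
  have : iota (p x) \in transversal iota (w x i).
    by rewrite -copyE -pE imset_f ?setU11.
  by case/imsetP => j _ /iota_inj->.
have memY x i j : j != (p x).1 -> iota (j, w x i j) \in phi @: Yset r s i.
  move=> jp; have : iota (j, w x i j) \in transversal iota (w x i).
    exact: imset_f.
  rewrite -copyE => /imsetP[v /setU1P[->|vY] E]; last by rewrite E imset_f.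
  by move: E jp; rewrite pE => /iota_inj<-; rewrite eqxx.
have Ymem x i u : u \in phi @: Yset r s i ->
    exists2 j, j != (p x).1 & u = iota (j, w x i j).
  case/imsetP => v vY ->; have : phi v \in transversal iota (w x i).
    by rewrite -copyE imset_f // setU1r.
  case/imsetP => j _ E; exists j => //; apply: contraTneq vY => jp.
  move: E; rewrite jp wp -surjective_pairing -pE => /phi_inj->.
  by apply/imsetP => -[].
have part x : (p x).1 = (p x0).1.
  apply/eqP/negPn/negP => /(memY x0 i0 _)/(Ymem x)[j jp].
  by move/iota_inj => -[jE _]; rewrite jE eqxx in jp.
exists (p x0).1, (fun x => (p x).2); split.
- move=> x x' E; suff [] : inl x = inl x' :> Kvertex r s t by [].
  apply: phi_inj; rewrite !pE [p x]surjective_pairing [p x']surjective_pairing.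
  by rewrite !part E.
- by move=> x i; rewrite -(part x) wp.
- move=> x x' i j; rewrite -(part x) => /(memY x i _)/(Ymem x')[j' _].
  by move/iota_inj => -[<-].
move=> x j jp i i' /= E; have jpx : j != (p x).1 by rewrite part.
have := memY x i j jpx; rewrite E => /imsetP[v vY vE].
have := memY x i' j jpx; rewrite vE => /imsetP[v' vY' /phi_inj vv'].
by move: vY vY'; rewrite vv' => /imsetP[y _ ->] /imsetP[y' _ []].
Qed.

(** * The norm hypergraph *)

Definition unpair (L : finType) (k : nat) (v : {ffun 'I_k -> L * L}) :
    {ffun 'I_k * bool -> L} :=
  [ffun j => if j.2 then (v j.1).2 else (v j.1).1].

Lemma unpair_inj (L : finType) (k : nat) : injective (@unpair L k).
Proof.
move=> v v' /ffunP vv'; apply/ffunP => i.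
have := (vv' (i, true), vv' (i, false)); rewrite !ffunE /=.
by case: (v i) (v' i) => [? ?] [? ?] /= [-> ->].
Qed.

Definition pairnorm (F : fieldType) (k q d : nat) (v : {ffun 'I_k -> F * F}) :
    F :=
  \prod_i qnorm q d ((v i).1 + (v i).2).

(** When [g] has order [q.-1], the exponents [c + e] are read cyclically, so the progression may
    wrap around. *)
Definition slab (F : finFieldType) (k q d h : nat) (g : F) (c : nat) :
    {set {ffun 'I_k -> F * F}} :=
  [set v | [exists e : 'I_h.+1, pairnorm q d v == g ^+ (c + e)]].

(** Through [iota] the 2k parts may sit inside a larger vertex set, whose other vertices are
    isolated. *)
Definition normgraph (F : finFieldType) (k q d h : nat) (g : F) (c : nat)
    (U : finType) (iota : 'I_k * bool * F -> U) : hypergraph U :=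
  [set transversal iota (unpair v) | v in slab k q d h g c].

Section NormGraph.
Variables (F : finFieldType) (k q d h : nat) (g : F) (c : nat).
Variables (U : finType) (iota : 'I_k * bool * F -> U).
Hypothesis iota_inj : injective iota.

Lemma card_normgraph : #|normgraph q d h g c iota| = #|slab k q d h g c|.
Proof.
by apply: card_imset => v v' /(transversal_inj iota_inj)/unpair_inj.
Qed.

Lemma normgraph_uniform : uniform (2 * k) (normgraph q d h g c iota).
Proof.
apply/forall_inP => _ /imsetP[v _ ->].
by rewrite card_transversal // card_prod card_ord card_bool mulnC.
Qed.

Lemma normgraph_K_free (t : nat) :
  [pchar F].-nat q -> (0 < d)%N -> g != 0 ->
  (h.*2.+1 ^ d * d`! < t)%N ->
  ~~ has_copy (K (2 * k) d.+1 t) (normgraph q d h g c iota).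
Proof.
move=> q_char d_gt0 g_neq0 t_gt; apply/negP => /existsP[phi].
case/andP => /injectiveP phi_inj /forall_inP phiK.
have edgeP x i : exists v, v \in slab k q d h g c /\
    phi @: (inl x |: Yset (2 * k) d.+1 i) = transversal iota (unpair v).
  have /phiK/imsetP[v vS vE] :
      inl x |: Yset (2 * k) d.+1 i \in K (2 * k) d.+1 t.
    by apply/imset2P; exists x i.
  by exists v.
have /fin_all_exists[v vP] x := fin_all_exists (edgeP x).
have progP x i : exists e : 'I_h.+1, pairnorm q d (v x i) = g ^+ (c + e).
  have [+ _] := vP x i.
  by rewrite inE => /existsP[e /eqP eE]; exists e.
have /fin_all_exists[e eP] x := fin_all_exists (progP x).
have t_gt0 : (0 < t)%N by apply: leq_ltn_trans t_gt.
have [] := K_copy_transversal iota_inj phi_inj (ltn0Sn d) t_gt0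
  (fun x i => proj2 (vP x i)).
move=> [l beta] [a [a_inj vl v_eq v_inj]].
(* [b i] is the element that Y_i contributes to the part paired with that of X; [R i] collects the
   other pairs, which are the same for every [x]. *)
pose b i := unpair (v ord0 i) (l, ~~ beta).
pose R i := \prod_(l' < k | l' != l)
  qnorm q d ((v ord0 i l').1 + (v ord0 i l').2).
have Nv x i : pairnorm q d (v x i) = qnorm q d (a x + b i) * R i.
  rewrite /pairnorm (bigD1 l) //=; congr (qnorm q d _ * _).
    rewrite -(vl x i) /b (v_eq ord0 x) ?xpair_eqE ?eqxx ?eqb_negLR //=.
      by rewrite !ffunE /=; case: (beta) => //; rewrite addrC.
    by case: (beta).
  apply: eq_bigr => l' l'l; have := v_eq x ord0 i (l', true).
  have := v_eq x ord0 i (l', false); rewrite !ffunE !xpair_eqE (negPf l'l) /=.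
  by move=> -> // ->.
(* Powers of [g] are nonzero, so no factor of the product norm vanishes. *)
have R_neq0 i : R i != 0.
  have : pairnorm q d (v ord0 i) != 0 by rewrite eP expf_neq0.
  by rewrite Nv mulf_eq0 negb_or => /andP[].
suff : (#|'I_t| <= h.*2.+1 ^ d * d`!)%N by rewrite card_ord leqNgt t_gt.
apply: (@card_qnorm_progression F q d h _ a b g (fun i => g ^+ c / R i)
  (fun x i => e x i)) => //.
- by apply: v_inj; rewrite xpair_eqE eqxx; case: (beta).
- by move=> x i; rewrite -ltnS.
move=> x i; apply: (mulIf (R_neq0 i)); rewrite -Nv eP exprD.
by rewrite mulrAC divfK.
Qed.

End NormGraph.

(** * Counting edges *)

Lemma card_neq0_pairs (F : finFieldType) :
  (#|F| ^ 2 <= 2 * #|[pred p : F * F | (p.1 + p.2 != 0)%R]|)%N.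
Proof.
set P := [pred p | _]; have := cardC P; rewrite card_prod.
(* The excluded pairs form the antidiagonal, at most half of all pairs since [F] has at least two
   elements. *)
have -> : #|predC P| = #|F|.
  rewrite -[RHS](card_image (f := fun x : F => (x, - x))); last first.
    by move=> x y [].
  apply: eq_card => -[x y]; rewrite !inE /= negbK addr_eq0.
  apply/eqP/imageP => [->|[z _ [-> ->]]]; last by rewrite opprK.
  by exists (- y); rewrite ?opprK.
move=> PF; rewrite -mulnn -PF mul2n -addnn leq_add2l -(leq_add2r #|F|) PF addnn.
by rewrite -mul2n leq_mul2r finNzRing_gt1 orbT.
Qed.

(** Double counting: a tuple with all pair sums nonzero has a power of [g] as product norm, hence
    lies in at least [h.+1] of the [q.-1] slabs; the largest slab reaches the average. *)
Lemma slab_average (F : finFieldType) (k q d h : nat) (g : F) :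
  #|F| = (q ^ d)%N -> (h < q.-1)%N -> q.-1.-primitive_root g ->
  exists c, (h.+1 * #|[pred p : F * F | (p.1 + p.2 != 0)%R]| ^ k <=
             q.-1 * #|slab k q d h g c|)%N.
Proof.
move=> cardF h_lt g_prim; set P := [pred p : F * F | _].
have m_gt0 : (0 < q.-1)%N by apply: leq_ltn_trans h_lt.
have q_gt0 : (0 < q)%N by case: (q) m_gt0.
pose W : {set {ffun 'I_k -> F * F}} := [set v in ffun_on P].
have cardW : #|W| = (#|P| ^ k)%N.
  by rewrite cardsE card_ffun_on card_ord.
have slabs v : v \in W ->
    (h.+1 <= \sum_(c < q.-1) (v \in slab k q d h g c))%N.
  rewrite inE => /ffun_onP vP.
  have : pairnorm q d v ^+ q.-1 = 1.
    rewrite /pairnorm -prodrXl big1 // => i _; apply: qnorm_expn => //.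
    exact: vP.
  move=> /(prim_rootP g_prim)[i vi].
  (* The solution of c + e = i modulo [q.-1]; adding [q.-1] first avoids truncated subtraction,
     since [e <= h < q.-1]. *)
  pose f (e : 'I_h.+1) : 'I_q.-1 := Ordinal (ltn_pmod (i + q.-1 - e) m_gt0).
  have f_add e : (f e + e = i %[mod q.-1])%N.
    rewrite /= modnDml subnK ?modnDr //.
    by rewrite (leq_trans _ (leq_addl _ _)) // (leq_trans _ h_lt) // ltnW.
  have f_inj : injective f.
    move=> e e' fe; apply/val_inj/eqP.
    have /eqP := etrans (f_add e) (esym (f_add e')); rewrite fe eqn_modDl.
    by rewrite !modn_small // (leq_trans (ltn_ord _)).
  rewrite -[X in (X <= _)%N]card_ord -(card_codom f_inj) -sum1_card big_mkcond.
  apply: leq_sum => c _; case: ifP => // /codomP[e ->].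
  rewrite inE lt0b; apply/existsP; exists e.
  by rewrite vi (eq_prim_root_expr g_prim) f_add.
pose c0 := [arg max_(c > Ordinal m_gt0) #|slab k q d h g c|].
exists c0; rewrite -cardW mulnC.
apply: (@leq_trans (\sum_(c < q.-1) #|slab k q d h g c|)).
  under eq_bigr do rewrite -sum1_card big_mkcond /=.
  rewrite exchange_big /= (bigID (mem W)) /= -sum_nat_const.
  apply: leq_trans (leq_addr _ _); apply: leq_sum => v /slabs /leq_trans; apply.
  by apply: leq_sum => c _; case: (_ \in _).
rewrite -[X in (_ <= X * _)%N](card_ord q.-1) -sum_nat_const.
apply: leq_sum => c _; rewrite /c0.
by case: arg_maxnP => // c' _ /(_ c isT).
Qed.

(** * Choice of parameters and passage to real exponents *)

Lemma ex_K_ge (d k t n m h : nat) :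
  (0 < d)%N -> (0 < k)%N -> (0 < m)%N -> (h.*2.+1 ^ d * d`! < t)%N ->
  (h < (2 ^ m).-1)%N -> (2 * k * (2 ^ m) ^ d <= n)%N ->
  (h.+1 * (2 ^ m) ^ (2 * k * d).-1 <=
   2 ^ k * ex (2 * k) n (K (2 * k) d.+1 t))%N.
Proof.
move=> d_gt0 k_gt0 m_gt0 t_gt h_lt n_ge; set q := (2 ^ m)%N in h_lt n_ge *.
have q_gt0 : (0 < q)%N by rewrite expn_gt0.
have m_d_gt0 : (0 < m * d)%N by rewrite muln_gt0 m_gt0.
have [F F_char cardF] : {F : finFieldType | 2 \in [pchar F] & #|F| = (q ^ d)%N}.
  by rewrite -expnM; apply: pPrimePowerField.
have q_char : [pchar F].-nat q.
  by rewrite pnatX (eq_pnat _ (pcharf_eq F_char)) pnat_id.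
clearbody q.
have [g g_prim] : exists g : F, q.-1.-primitive_root g.
  by apply: finField_prim_root; rewrite cardF predn_exp dvdn_mulr.
have g_neq0 : g != 0.
  by rewrite (prim_root_eq0 g_prim) -leqn0 -ltnNge (leq_ltn_trans _ h_lt).
have [c c_ge] := slab_average k cardF h_lt g_prim.
have le_n : (#|{: 'I_k * bool * F}| <= n)%N.
  by rewrite !card_prod card_ord card_bool cardF (mulnC k).
pose iota (x : 'I_k * bool * F) := widen_ord le_n (enum_rank x).
have iota_inj : injective iota.
  by move=> x y /(congr1 val) /= /val_inj/enum_rank_inj.
have ex_ge : (#|slab k q d h g c| <= ex (2 * k) n (K (2 * k) d.+1 t))%N.
  rewrite -(card_normgraph q d h g c iota_inj).
  apply: (leq_bigmax_cond (F := fun G : hypergraph 'I_n => #|G|)).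
  by rewrite normgraph_uniform ?normgraph_K_free.
(* Each of the [k] pairs loses at most a factor 2, whence [2 ^ k]. Multiplying by [q] turns the left
   side into [h.+1] times the number of all tuples. *)
have := card_neq0_pairs F.
rewrite cardF; set P := #|[pred _ | _]| in c_ge * => P_ge; rewrite -(leq_pmul2l q_gt0).
have -> : (q * (h.+1 * q ^ (2 * k * d).-1) = h.+1 * ((q ^ d) ^ 2) ^ k)%N.
  rewrite mulnCA -expnS prednK ?muln_gt0 ?d_gt0 ?k_gt0 //.
  by rewrite -!(expnM q) [(2 * k * d)%N]mulnC mulnA.
apply: (@leq_trans (h.+1 * (2 * P) ^ k)); first by rewrite leq_mul2l leq_exp2r.
rewrite expnMn mulnCA [X in (_ <= X)%N]mulnCA leq_mul2l; apply/orP; right.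
by apply: leq_trans c_ge _; rewrite leq_mul ?leq_pred.
Qed.

(** The [d]-th power of the desired bound, free of roots. Both [h] and q = [2 ^ m] are chosen
    maximal, which bounds [t] and [n] by constants times [h.+1 ^ d] and q^d. *)
Lemma ex_K_nat (d k t : nat) :
  (0 < d)%N -> (0 < k)%N -> (d`! < t)%N ->
  exists N, forall n, (N <= n)%N ->
    (t * n ^ (2 * k * d).-1 <=
     3 ^ d * d`! * ((2 * k) * 2 ^ d) ^ (2 * k * d).-1 * (2 ^ k) ^ d *
     ex (2 * k) n (K (2 * k) d.+1 t) ^ d)%N.
Proof.
move=> d_gt0 k_gt0 t_gt; set E := (2 * k * d).-1.
pose hP h := (h.*2.+1 ^ d * d`! < t)%N.
(* The lower bound on [t] says precisely that [h = 0] is admissible. *)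
have hP0 : exists h, hP h by exists 0%N; rewrite /hP exp1n mul1n.
have hP_le h : hP h -> (h <= t)%N.
  move/ltnW; apply: leq_trans.
  rewrite -[h]muln1 leq_mul ?fact_gt0 //.
  apply: leq_trans (leq_pexp2l (ltn0Sn _) d_gt0).
  by rewrite expn1; lia.
case: (ex_maxnP hP0 hP_le) => h h_ok h_max.
(* Maximality of [h], with 2(h + 1) + 1 <= 3(h + 1). *)
have t_le : (t <= 3 ^ d * d`! * h.+1 ^ d)%N.
  have : ~~ hP h.+1 by apply/negP => /h_max; rewrite ltnn.
  rewrite -leqNgt => /leq_trans; apply.
  rewrite mulnAC -expnMn leq_mul2r leq_exp2r //.
  by apply/orP; right; lia.
(* This threshold forces [h.+2 <= m], hence [h < (2 ^ m).-1]; it depends on [t] through [h]. *)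
exists (2 * k * (2 ^ h.+2) ^ d)%N => n n_ge.
pose mP m := (2 * k * (2 ^ m) ^ d <= n)%N.
have mP0 : exists m, mP m by exists h.+2.
have mP_le m : mP m -> (m <= n)%N.
  apply: leq_trans; apply: leq_trans (ltnW (ltn_expl m (ltnSn 1))) _.
  rewrite -[X in (X <= _)%N]mul1n leq_mul ?muln_gt0 ?k_gt0 //.
  by rewrite -{1}[(2 ^ m)%N]expn1 leq_pexp2l // expn_gt0.
case: (ex_maxnP mP0 mP_le) => m m_ok m_max.
have m_ge : (h.+2 <= m)%N by apply: m_max.
have n_le : (n <= (2 * k) * 2 ^ d * (2 ^ m) ^ d)%N.
  have : ~~ mP m.+1 by apply/negP => /m_max; rewrite ltnn.
  by rewrite -ltnNge => /ltnW; rewrite expnS expnMn mulnA.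
have h_lt : (h < (2 ^ m).-1)%N.
  rewrite -ltnS prednK ?expn_gt0 // (leq_trans m_ge) //.
  exact: ltnW (ltn_expl m (ltnSn 1)).
have m_gt0 : (0 < m)%N by apply: leq_trans m_ge.
have := ex_K_ge d_gt0 k_gt0 m_gt0 h_ok h_lt m_ok; rewrite -/E.
rewrite -(@leq_exp2r _ _ d) // expnMn => e_ge.
have E_gt0 : (0 < E)%N by rewrite /E; nia.
move: n_le; rewrite -(@leq_exp2r _ _ E) // => n_le.
apply: leq_trans (leq_mul t_le n_le) _.
rewrite expnMn mulnACA -[X in (_ <= X)%N]mulnA leq_mul2l; apply/orP; right.
by rewrite -[X in (_ <= X)%N]expnMn -(expnM (2 ^ m)) [(d * E)%N]mulnC expnM.
Qed.

(** Take [d]-th roots: E / d = r - 1/d because E + 1 = r d. *)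
Lemma exponent_root (R : realType) (C t n e E d r : nat) :
  (0 < C)%N -> (0 < d)%N -> (E.+1 = r * d)%N -> (t * n ^ E <= C * e ^ d)%N ->
  (C%:R : R) `^ (- d%:R^-1) * t%:R `^ (1 / d%:R) * n%:R `^ (r%:R - 1 / d%:R)
  <= e%:R.
Proof.
move=> C_gt0 d_gt0 Erd; rewrite -(ler_nat R) !natrM !natrX => le_e.
have d_neq0 : d%:R != 0 :> R by rewrite pnatr_eq0 -lt0n.
have dV : 0 <= d%:R^-1 :> R by rewrite invr_ge0.
have := ge0_ler_powR dV _ _ le_e; rewrite !nnegrE !mulr_ge0 ?exprn_ge0 //.
move=> /(_ isT isT); rewrite !powRM ?exprn_ge0 // -!powR_mulrn // -!powRrM.
rewrite mulfV // powRr1 //.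
have -> : E%:R * d%:R^-1 = r%:R - 1 / d%:R :> R.
  have -> : E%:R = r%:R * d%:R - 1 :> R by rewrite -natrM -Erd -natr1 addrK.
  by rewrite mulrBl mulfK.
by rewrite powRN div1r -mulrA ler_pdivrMl // powR_gt0 ?ltr0n.
Qed.

Unset Implicit Arguments.

Theorem theorem1p2 (R : realType) (s k : nat) (hs : (2 <= s)%N) (hk : (0 < k)%N) :
  exists c : R, 0 < c /\
    forall t : nat, ((s - 1)`! < t)%N ->
      exists N : nat, forall n : nat, (N <= n)%N ->
        c * t%:R `^ (1 / (s%:R - 1))
          * n%:R `^ ((2 * k)%:R - 1 / (s%:R - 1))
        <= (ex (2 * k) n (K (2 * k) s t))%:R.
Proof.
case: s hs => // d; rewrite ltnS => d_gt0; rewrite subn1 -natr1 addrK /=.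
(* The constant of [ex_K_nat]; it involves only [k] and d = s - 1, so its inverse [d]-th root can
   serve as [c]. *)
set C := (3 ^ d * d`! * ((2 * k) * 2 ^ d) ^ (2 * k * d).-1 * (2 ^ k) ^ d)%N.
have C_gt0 : (0 < C)%N.
  by rewrite !muln_gt0 !expn_gt0 fact_gt0 !muln_gt0 expn_gt0 hk.
exists (C%:R `^ (- d%:R^-1)); split; first by rewrite powR_gt0 ?ltr0n.
move=> t t_gt; have [N le_ex] := ex_K_nat d_gt0 hk t_gt.
exists N => n /le_ex; apply: exponent_root => //.
by rewrite prednK // !muln_gt0 hk.
Qed.
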